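(* Let $\overline\Pi$ be a possibility measure on $\mathbb{U}$, with contour $\pi$, that is compatible with $\mathsf{P}_U$, and for each $y \in \mathbb{Y}$ let $\overline\Pi_y$ and $\underline\Pi_y$ be the posterior possibility and necessity measures on $\Theta$ determined by $\pi$ and the association $a(Y,\theta,U)=0$. Then the posterior possibility measure is valid in the sense that $$\sup_{\theta \in A} \mathsf{P}_{Y|\theta}\{\overline\Pi_Y(A) \leq \alpha\} \leq \alpha \quad \text{for all } A \subseteq \Theta \text{ and all } \alpha \in [0,1].$$ Similarly, the posterior necessity measure satisfies $$\sup_{\theta \notin A} \mathsf{P}_{Y|\theta}\{\underline\Pi_Y(A) \geq 1-\alpha\} \leq \alpha \quad \text{for all } A \subseteq \Theta \text{ and all } \alpha \in [0,1].$$
   Context: Statistical model and association. The observable data $Y$ takes values in $\mathbb{Y}$ and has distribution $\mathsf{P}_{Y|\theta}$ depending on an unknown parameter $\theta \in \Theta$. An auxiliary variable $U$ takes values in $\mathbb{U}$ with known distribution $\mathsf{P}_U$. The model is represented by an association $a(Y,\theta,U)=0$, with $a$ a known mapping: for each $\theta \in \Theta$, data $Y \sim \mathsf{P}_{Y|\theta}$ are associated with $U \sim \mathsf{P}_U$ through $a(Y,\theta,U)=0$; that is, $(Y,U)$ can be realized jointly with $Y \sim \mathsf{P}_{Y|\theta}$, $U \sim \mathsf{P}_U$ and $a(Y,\theta,U)=0$. For $y \in \mathbb{Y}$ and $\vartheta \in \Theta$, write $\mathbb{U}_y(\vartheta) = \{u \in \mathbb{U} : a(y,\vartheta,u)=0\}$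 (in continuous-data problems this set is a singleton). It is assumed throughout that $\bigcup_{\vartheta \in \Theta} \mathbb{U}_y(\vartheta) = \mathbb{U}$ for all $y \in \mathbb{Y}$. Possibility measures. A possibility contour on $\mathbb{U}$ is a function $\pi : \mathbb{U} \to [0,1]$ with $\sup_{u \in \mathbb{U}} \pi(u) = 1$; its possibility measure is $\overline\Pi(K) = \sup_{u \in K} \pi(u)$ for $K \subseteq \mathbb{U}$, where the supremum over the empty set is $0$. $\overline\Pi$ is compatible with $\mathsf{P}_U$ if $\mathsf{P}_U(K) \leq \overline\Pi(K)$ for all measurable $K \subseteq \mathbb{U}$. (An example is the contour $\pi(u) = \mathsf{P}_U\{f(U) < f(u)\}$, with $f$ the density of $\mathsf{P}_U$.) Posterior quantities. The posterior possibility contour is $\pi_y(\vartheta) = \sup_{u \in \mathbb{U}_y(\vartheta)} \pi(u)$ for $\vartheta \in \Theta$. The posterior possibility measure is $\overline\Pi_y(A) = \sup_{\vartheta \in A} \pi_y(\vartheta)$ for $A \subseteq \Theta$, with supremum over the empty set equal to $0$, and the posterior necessity measure is $\underline\Pi_y(A) = 1 - \overline\Pi_y(A^c)$, where $A^c = \Theta \setminus A$. The contour $\pi$ is taken to be measurable, and the events inside $\mathsf{P}_{Y|\theta}\{\cdot\}$ are taken to be measurable. Suprema over an empty set of $\theta$'s (when $A = \varnothing$ or $A = \Theta$) are $0$. *)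

(* Defs.v *)
From HB Require Import structures.
From mathcomp Require Import all_boot all_order all_algebra.
From mathcomp Require Import all_classical all_reals all_analysis.

Set Implicit Arguments.
Unset Strict Implicit.
Unset Printing Implicit Defensive.

Import Order.TTheory GRing.Theory Num.Theory.
Local Open Scope classical_set_scope.
Local Open Scope ring_scope.

Definition possibility_contour (R : realType) (T : Type) (p : T -> R) : Prop :=
  (forall t, 0 <= p t <= 1) /\ sup (range p) = 1.

(* The real supremum has sup set0 = 0, which is the convention wanted for the
   empty set; the functions p of interest take values in [0, 1], so that the
   suprema are always over bounded sets. *)
Definition possibility (R : realType) (T : Type) (p : T -> R) (K : set T) : R :=
  sup (p @` K).

Definition necessity (R : realType) (T : Type) (p : T -> R) (K : set T) : R :=
  1 - possibility p (~` K).

Definition compatible (R : realType) (d : measure_display)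
    (T : measurableType d) (PU : probability T R) (p : T -> R) : Prop :=
  forall K : set T, measurable K -> (PU K <= (possibility p K)%:E)%E.

(* The codomain of an association only serves to provide the value 0. *)
Definition solutions (Y Theta U : Type) (E : nmodType)
    (a : Y -> Theta -> U -> E) (y : Y) (theta : Theta) : set U :=
  [set u | a y theta u = 0].

(* The joint realization (Y, U) lives on an arbitrary probability space, and the
   equation is only required to hold almost surely. *)
Definition association (R : realType) (dY dU : measure_display)
    (Y : measurableType dY) (U : measurableType dU) (Theta : Type)
    (E : nmodType) (a : Y -> Theta -> U -> E)
    (PY : Theta -> probability Y R) (PU : probability U R) : Prop :=
  forall theta : Theta,
    exists (d : measure_display) (Omega : measurableType d)
           (P : probability Omega R)
           (Yv : {RV P >-> Y}) (Uv : {RV P >-> U}),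
      [/\ forall B, measurable B -> distribution P Yv B = PY theta B,
          forall B, measurable B -> distribution P Uv B = PU B &
          {ae P, forall w, a (Yv w) theta (Uv w) = 0}].

Definition posterior_contour (R : realType) (Y Theta U : Type) (E : nmodType)
    (a : Y -> Theta -> U -> E) (p : U -> R) (y : Y) : Theta -> R :=
  fun theta => possibility p (solutions a y theta).

Definition posterior_possibility (R : realType) (Y Theta U : Type)
    (E : nmodType) (a : Y -> Theta -> U -> E) (p : U -> R) (y : Y)
    (A : set Theta) : R :=
  possibility (posterior_contour a p y) A.

Definition posterior_necessity (R : realType) (Y Theta U : Type)
    (E : nmodType) (a : Y -> Theta -> U -> E) (p : U -> R) (y : Y)
    (A : set Theta) : R :=
  necessity (posterior_contour a p y) A.

(* Supremum over theta in A of the probability of the event B under PY theta;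
   it is 0 when A is empty. *)
Definition sup_prob (R : realType) (d : measure_display) (Y : measurableType d)
    (Theta : Type) (PY : Theta -> probability Y R) (A : set Theta)
    (B : set Y) : R :=
  sup [set fine (PY theta B) | theta in A].

(* Main.v *)
Require Import Defs.
From HB Require Import structures.
From mathcomp Require Import all_boot all_order all_algebra.
From mathcomp Require Import all_classical all_reals all_analysis.

Set Implicit Arguments.
Unset Strict Implicit.
Unset Printing Implicit Defensive.

Import Order.TTheory GRing.Theory Num.Theory.
Local Open Scope classical_set_scope.
Local Open Scope ring_scope.

(** The whole statement reduces to one observation.  Realize data Y and auxiliary
variable U jointly under the parameter theta, with a(Y, theta, U) = 0 almost
surely.  If theta lies in A, then almost surely U is one of the points over
which the posterior contour at theta is a supremum, whence
  p U <= posterior contour of Y at theta <= posterior possibility of A given Y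
([contour_le_posterior_possibility]).  The event that the posterior possibility
of A is at most alpha therefore forces p U <= alpha up to a null set.  By
compatibility the latter event has probability at most the supremum of p over
the sublevel set where p <= alpha, and that supremum is at most alpha
([compatible_sublevel]).

The claim on the necessity of A is the claim on the possibility of its
complement, since 1 - alpha <= 1 - x is equivalent to x <= alpha. *)

Section Possibility.
Context {R : realType} {T : Type}.
Implicit Types (p : T -> R) (K : set T) (c : R).

(** Nonnegativity of the bound takes care of the empty set. *)
Lemma possibility_le p K c :
  0 <= c -> (forall t, K t -> p t <= c) -> possibility p K <= c.
Proof.
move=> c0 pc; rewrite /possibility.
have [->|/set0P[t Kt]] := eqVneq K set0; first by rewrite image_set0 sup0.
by apply: ge_sup => [|_ [s Ks <-]]; [exists (p t), t|exact: pc].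
Qed.

Lemma le_possibility p K c t :
  (forall s, p s <= c) -> K t -> p t <= possibility p K.
Proof.
move=> pc Kt; apply: ub_le_sup; last by exists t.
by exists c => _ [s _ <-].
Qed.

End Possibility.

Lemma contour_le_posterior_possibility (R : realType) (Y Theta U : Type)
    (E : nmodType) (a : Y -> Theta -> U -> E) (p : U -> R) (y : Y)
    (A : set Theta) (theta : Theta) (u : U) :
  (forall v, p v <= 1) -> A theta -> a y theta u = 0 ->
  p u <= posterior_possibility a p y A.
Proof.
move=> p1 Atheta au.
have le_contour : p u <= posterior_contour a p y theta by exact: le_possibility p1 au.
apply: (le_trans le_contour); apply: le_possibility Atheta => t.
exact: possibility_le.
Qed.

(** A contour compatible with [PU] is stochastically no smaller than a uniform
variable: its sublevel set at [alpha] has probability at most [alpha]. *)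
Lemma compatible_sublevel (R : realType) (d : measure_display)
    (U : measurableType d) (PU : probability U R) (p : U -> R) (alpha : R) :
  measurable_fun [set: U] p -> compatible PU p -> 0 <= alpha ->
  measurable [set u | p u <= alpha] /\
  (PU [set u | (p u <= alpha)%R] <= alpha%:E)%E.
Proof.
move=> mp cp alpha0.
have mK : measurable [set u | p u <= alpha].
  have -> : [set u | p u <= alpha] = [set: U] `&` p @^-1` `]-oo, alpha].
    by rewrite setTI; apply/seteqP; split=> u /=; rewrite in_itv.
  exact: mp.
split=> //; apply: (le_trans (cp _ mK)).
by rewrite lee_fin; exact: possibility_le.
Qed.

(** Almost sure inclusion of events, for two variables realized jointly, bounds
the law of one by the law of the other. *)
Lemma le_distribution_ae (R : realType) (d dY dU : measure_display)
    (Omega : measurableType d) (Y : measurableType dY) (U : measurableType dU)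
    (P : probability Omega R) (Yv : {RV P >-> Y}) (Uv : {RV P >-> U})
    (B : set Y) (K : set U) :
  measurable B -> measurable K -> {ae P, forall w, B (Yv w) -> K (Uv w)} ->
  (distribution P Yv B <= distribution P Uv K)%E.
Proof.
move=> mB mK [N [mN PN0 subN]].
have mYB : measurable (Yv @^-1` B) by rewrite -[X in measurable X]setTI; exact: measurable_funPT.
have mUK : measurable (Uv @^-1` K) by rewrite -[X in measurable X]setTI; exact: measurable_funPT.
rewrite /distribution /pushforward -[leRHS](measureU0 mUK mN PN0).
apply: le_measure; rewrite ?inE //; first exact: measurableU.
move=> w YBw; have [|nK] := pselect (K (Uv w)); first by left.
by right; apply: subN => /(_ YBw).
Qed.

Lemma sup_prob_le (R : realType) (d : measure_display) (Y : measurableType d)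
    (Theta : Type) (PY : Theta -> probability Y R) (A : set Theta) (B : set Y)
    (alpha : R) :
  0 <= alpha -> measurable B ->
  (forall theta, A theta -> (PY theta B <= alpha%:E)%E) ->
  sup_prob PY A B <= alpha.
Proof.
move=> alpha0 mB PB; apply: possibility_le => // theta /PB.
by rewrite -[X in (X <= _)%E]fineK ?lee_fin// fin_num_measure.
Qed.

Lemma posterior_possibility_valid (R : realType) (dY dU : measure_display)
    (Y : measurableType dY) (U : measurableType dU) (Theta : Type)
    (E : nmodType) (a : Y -> Theta -> U -> E)
    (PY : Theta -> probability Y R) (PU : probability U R) (p : U -> R)
    (A : set Theta) (alpha : R) :
  association a PY PU -> (forall u, p u <= 1) -> measurable_fun [set: U] p ->
  compatible PU p -> 0 <= alpha ->
  measurable [set y | posterior_possibility a p y A <= alpha] ->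
  sup_prob PY A [set y | posterior_possibility a p y A <= alpha] <= alpha.
Proof.
move=> assoc p1 mp cp alpha0 mB; apply: sup_prob_le => // theta Atheta.
have [mK PK] := compatible_sublevel mp cp alpha0.
have [d [W [P [Yv [Uv [PYv PUv aYU]]]]]] := assoc theta.
rewrite -PYv//; apply: le_trans PK; rewrite -PUv//.
apply: le_distribution_ae => //.
apply: filterS aYU => w aw /=; apply: le_trans.
exact: contour_le_posterior_possibility aw.
Qed.

Theorem proposition3 (R : realType) (dY dU : measure_display)
  (Y : measurableType dY) (U : measurableType dU) (Theta : Type)
  (E : nmodType) (a : Y -> Theta -> U -> E)
  (PY : Theta -> probability Y R) (PU : probability U R)
  (assoc : association a PY PU)
  (cover : forall y : Y, \bigcup_(theta in [set: Theta]) solutions a y theta = [set: U])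
  (p : U -> R)
  (p_contour : possibility_contour p)
  (p_meas : measurable_fun [set: U] p)
  (p_compat : compatible PU p) :
  (forall (A : set Theta) (alpha : R), 0 <= alpha <= 1 ->
     measurable [set y : Y | posterior_possibility a p y A <= alpha] ->
     sup_prob PY A [set y : Y | posterior_possibility a p y A <= alpha] <= alpha)
  /\
  (forall (A : set Theta) (alpha : R), 0 <= alpha <= 1 ->
     measurable [set y : Y | 1 - alpha <= posterior_necessity a p y A] ->
     sup_prob PY (~` A) [set y : Y | 1 - alpha <= posterior_necessity a p y A] <= alpha).
Proof.
have p1 u : p u <= 1 by have /andP[] := p_contour.1 u.
split=> A alpha /andP[alpha0 _]; first exact: posterior_possibility_valid p_compat _.
have -> : [set y | 1 - alpha <= posterior_necessity a p y A] =
          [set y | posterior_possibility a p y (~` A) <= alpha].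
  by apply/seteqP; split=> y /=; rewrite /posterior_necessity /necessity lerD2l lerN2.
exact: posterior_possibility_valid p_compat _.
Qed.
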